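(* Let $r$ be a positive integer, let $n\ge 1$ be a real number, and let $G$ be a graph with $iso(G\setminus S)\le \frac{|S|}{r+1/n}$ for all $S\subseteq V(G)$. If for all $S\subseteq V(G)$ $$\omega(G\setminus S)<\frac{1}{n}|S|+2,$$ then $G$ has a near $r$-factor. In particular, every $1$-tough graph $G$ with $iso(G\setminus S)\le \frac{|S|}{r+1}$ for all $S\subseteq V(G)$ has a near $r$-factor.
   Context: Graphs are finite, have no loops, but may have multiple edges; degrees count multiplicities. For $S\subseteq V(G)$, $G\setminus S$ is the graph obtained by deleting $S$; $\omega(\cdot)$ is the number of connected components and $iso(\cdot)$ the number of isolated vertices. A graph is $t$-tough ($t>0$ real) if $\omega(G\setminus S)\le\max\{1,|S|/t\}$ for all $S\subseteq V(G)$. A near $r$-factor is a spanning subgraph in which every vertex has degree $r$, except for at most one vertex of degree $r+1$. *)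

(* Defs.v *)
From HB Require Import structures.
From mathcomp Require Import all_boot all_order all_algebra.
Set Implicit Arguments. Unset Strict Implicit. Unset Printing Implicit Defensive.
Import Order.TTheory GRing.Theory Num.Theory.

(* A finite multigraph without loops on vertex type T is given by an
   edge-multiplicity function m : T -> T -> nat, symmetric, with m x x = 0. *)
Definition multigraph (T : finType) (m : T -> T -> nat) : Prop :=
  (forall x y, m x y = m y x) /\ (forall x, m x x = 0%N).

Definition deg (T : finType) (m : T -> T -> nat) (x : T) : nat :=
  (\sum_(y : T) m x y)%N.

Definition adjD (T : finType) (m : T -> T -> nat) (S : {set T}) : rel T :=
  fun x y => [&& x \notin S, y \notin S & (0 < m x y)%N].

Definition omega (T : finType) (m : T -> T -> nat) (S : {set T}) : nat :=
  #|[set fingraph.root (adjD m S) x | x in ~: S]|.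

Definition iso (T : finType) (m : T -> T -> nat) (S : {set T}) : nat :=
  #|[set x in ~: S | [forall y in ~: S, m x y == 0%N]]|.

Definition tough (R : realFieldType) (T : finType) (m : T -> T -> nat) (t : R) : Prop :=
  forall S : {set T}, ((omega m S)%:R <= Num.max 1 ((#|S|)%:R / t))%R.

Definition spanning_subgraph (T : finType) (F m : T -> T -> nat) : Prop :=
  multigraph F /\ (forall x y, F x y <= m x y)%N.

Definition near_factor (T : finType) (F : T -> T -> nat) (r : nat) : Prop :=
  (forall x, deg F x = r \/ deg F x = r.+1) /\
  (forall x y, deg F x = r.+1 -> deg F y = r.+1 -> x = y).

Definition has_near_factor (T : finType) (m : T -> T -> nat) (r : nat) : Prop :=
  exists F, spanning_subgraph F m /\ near_factor F r.

(* Main.v *)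
Require Import Defs.
From HB Require Import structures.
From mathcomp Require Import all_boot all_order all_algebra.
From mathcomp Require Import zify lra.
Import Order.TTheory GRing.Theory Num.Theory.
Set Implicit Arguments. Unset Strict Implicit. Unset Printing Implicit Defensive.

(** Near r-factors of G correspond to factors with prescribed degrees of the cone
over G. If there is none, Tutte's f-factor theorem (obtained from the Tutte-Berge
formula through a gadget graph) yields disjoint sets S and T of vertices, chosen
so that every vertex of T has few neighbours inside T, such that

  r |S| + 2 <= sum_(x in T) (r - d(x)) + omega(G \ (S u T)),

where d is the degree in G \ S (the positions of the apex relative to S and T give
variants of this inequality). A greedy choice produces an independent set I in T
with sum_T (r + 1/n - d) <= (r - 1) sum_I (r + 1/n - d), and the vertices of I are
isolated once S and their neighbours are deleted, so this is at most
(r - 1) |S|. Bounding omega(G \ (S u T)) by (|S| + |T|) / n + 2 then gives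
r |S| < (r - 1) |S| + |S| / n, which is absurd. *)

(** * Parity under involutions and components of induced subgraphs *)

Lemma odd_card_fixed (V : finType) (g : V -> V) (A : {set V}) :
  involutive g -> (forall x, x \in A -> g x \in A) ->
  odd #|[set x in A | g x == x]| = odd #|A|.
Proof.
move=> gK gA.
(* From each two-element orbit of [g], [lo] keeps the element of smaller rank, and [g] maps [lo]
   onto the others, so the non-fixed points are even in number. *)
pose lo := [set x in A | enum_rank x < enum_rank (g x)].
have hiE : A :\: [set x in A | g x == x] :\: lo = g @: lo.
  apply/setP=> x; apply/idP/imsetP.
    rewrite !inE => /andP[xlo /andP[xfix xA]]; exists (g x); last by rewrite gK.
    rewrite inE gA // gK ltn_neqAle; rewrite xA /= -leqNgt in xlo.
    rewrite xlo andbT; apply: contra xfix => /eqP/val_inj/enum_rank_inj ->.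
    by rewrite xA /=.
  case=> y; rewrite inE => /andP[yA lty] ->; rewrite !inE gK gA //=.
  rewrite -leqNgt (ltnW lty) /= andbT; apply: contraTneq lty => <-.
  by rewrite ltnn.
have loS : lo \subset A :\: [set x in A | g x == x].
  apply/subsetP=> x; rewrite !inE => /andP[xA lt]; rewrite xA /= andbT.
  by apply: contraTneq lt => ->; rewrite ltnn.
have h1 := cardsID [set x in A | g x == x] A.
have h2 := cardsID lo (A :\: [set x in A | g x == x]).
rewrite hiE (setIidPr loS) (card_imset _ (can_inj gK)) in h2.
rewrite -h1 -h2 (setIidPr _); last by apply/subsetP=> x; rewrite inE => /andP[].
by rewrite oddD addnn odd_double addbF.
Qed.

Section Components.

Variables (V : finType) (e : rel V).
Hypothesis esym : symmetric e.
Implicit Types (W X Y C : {set V}).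

Definition induced W : rel V := fun x y => [&& x \in W, y \in W & e x y].

Definition class W x := [set y in W | connect (induced W) x y].

Definition components W : {set {set V}} := [set class W x | x in W].

Definition odd_components W := [set C in components W | odd #|C|].

Lemma connect_induced_sym W : connect_sym (induced W).
Proof. by apply: sym_connect_sym => x y; rewrite /induced esym andbCA. Qed.

Lemma connect_induced_mem W x y :
  connect (induced W) x y -> x \in W -> y \in W.
Proof.
move=> /connectP[p pth ->]; elim: p x pth => //= z p IHp x /andP[/and3P[_ zW _]].
by move=> pth _; apply: IHp pth zW.
Qed.

Lemma class_refl W x : x \in W -> x \in class W x.
Proof. by move=> xW; rewrite inE xW connect0. Qed.

Lemma class_connect W x y : connect (induced W) x y -> class W x = class W y.
Proof.
move=> cxy; apply/setP=> z; rewrite !inE.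
by rewrite (same_connect (@connect_induced_sym W) cxy).
Qed.

Lemma class_adj W x y : x \in W -> y \in W -> e x y -> class W x = class W y.
Proof.
by move=> xW yW exy; apply/class_connect/connect1; rewrite /induced xW yW.
Qed.

Lemma component_class W C x : C \in components W -> x \in C -> C = class W x.
Proof. by case/imsetP=> y yW ->; rewrite inE => /andP[_ /class_connect]. Qed.

Lemma components_partition W : partition (components W) W.
Proof.
apply: equivalence_partitionP => x y z _ _ _; split; first exact: connect0.
by move=> /(same_connect (@connect_induced_sym W)) ->.
Qed.

Lemma odd_card_odd_components W : odd #|odd_components W| = odd #|W|.
Proof.
rewrite (card_partition (components_partition W)).
rewrite -sum1_card !(big_morph odd oddD (erefl (odd 0))).
rewrite (eq_bigl (fun C => (C \in components W) && odd #|C|)); last first.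
  by move=> C; rewrite inE.
by rewrite big_mkcondr; apply: eq_bigr => C _; case: ifP.
Qed.

Definition adj_components W Y :=
  [set C in odd_components W | [exists x in C, exists y in Y, e x y]].

(** An odd component of [W] without edges to [Y] is still a component after [Y] is added. *)
Lemma card_odd_components_setU W Y :
  #|odd_components W| <= #|odd_components (W :|: Y)| + #|adj_components W Y|.
Proof.
rewrite -(cardsID (adj_components W Y)) addnC leq_add //; last first.
  by rewrite subset_leq_card // subsetIr.
apply/subset_leq_card/subsetP=> C; rewrite !inE => /andP[/negP nadj].
move=> /andP[Ccomp oddC]; rewrite Ccomp oddC /= in nadj; rewrite oddC andbT.
case/imsetP: (Ccomp) => x xW CE; apply/imsetP; exists x; first by rewrite inE xW.
rewrite CE; apply/setP=> y; rewrite !inE; apply/andP/andP=> -[yW cxy].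
  rewrite yW; split=> //; apply: connect_sub cxy => a b /and3P[aW bW eab].
  by apply: connect1; rewrite /induced !inE aW bW.
have Ccl : closed (induced (W :|: Y)) C.
  apply: intro_closed => [a b|a b /and3P[aWY bWY eab] aC].
    exact: connect_induced_sym.
  have aW : a \in W by move: aC; rewrite CE inE => /andP[].
  have [bW|bW] := boolP (b \in W).
    by rewrite (component_class Ccomp aC) (class_adj aW bW eab) class_refl.
  rewrite inE (negPf bW) /= in bWY; case: nadj.
  by apply/existsP; exists a; rewrite aC; apply/existsP; exists b; rewrite bWY.
have: y \in C by rewrite -(closed_connect Ccl cxy) CE class_refl.
by rewrite CE inE => /andP.
Qed.

End Components.

(** * Matchings, Gallai's lemma and the Tutte-Berge formula *)

Section Matchings.

Variables (V : finType) (e : rel V).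
Hypothesis esym : symmetric e.
Implicit Types (W X : {set V}) (M N : {ffun V -> V}).

(* A matching of the subgraph induced on W is encoded by its mate involution,
   whose fixed points are the unmatched vertices. *)
Definition matching W : pred {ffun V -> V} := fun M =>
  [forall x, (M (M x) == x) && ((M x != x) ==> (x \in W) && e x (M x))].

Definition missed W M := [set x in W | M x == x].

Definition maximum W M :=
  matching W M /\ forall N, matching W N -> #|missed W M| <= #|missed W N|.

Lemma matchingP W M :
  reflect ((forall x, M (M x) = x) /\
           forall x, M x != x -> x \in W /\ e x (M x))
          (matching W M).
Proof.
apply: (iffP forallP) => [mM|[MK Me] x].
  split=> x; have /andP[/eqP MK /implyP Me] := mM x; first exact: MK.
  by move/Me/andP.
by rewrite MK eqxx; apply/implyP=> /Me[-> ->].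
Qed.

Lemma matching_mem W M x : matching W M -> x \in W -> M x \in W.
Proof.
case/matchingP=> MK Me xW; have [->//|Mx] := eqVneq (M x) x.
by have [] := Me (M x); rewrite // MK eq_sym.
Qed.

Lemma maximum_exists W : exists M, maximum W M.
Proof.
have m0 : matching W [ffun x => x].
  by apply/matchingP; split=> x; rewrite !ffunE ?eqxx.
by case: (arg_minnP (fun M => #|missed W M|) m0) => M mM minM; exists M.
Qed.

(** Meant for [x] missed by [M]: the edge [xy] enters and the old edge at [y] leaves, so that [M y]
    becomes missed. If [y] was missed too, the matching is simply augmented. *)
Definition rematch M x y : {ffun V -> V} :=
  [ffun a => if a == x then y else if a == y then x
             else if a == M y then M y else M a].

Lemma rematch_matching W M x y : matching W M -> M x = x -> x != y ->
  x \in W -> y \in W -> e x y -> matching W (rematch M x y).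
Proof.
case/matchingP=> MK Me Mx xy xW yW exy; apply/matchingP; split=> a; rewrite !ffunE.
  have [->|ax] := eqVneq a x; first by rewrite eq_sym (negPf xy) eqxx.
  have [->|ay] := eqVneq a y; first by rewrite eqxx.
  have [aMy|aMy] := eqVneq a (M y); last first.
    have -> : (M a == x) = false by apply/eqP=> Ma; rewrite -[a]MK Ma Mx eqxx in ax.
    have -> : (M a == y) = false by apply/eqP=> Ma; rewrite -[a]MK Ma eqxx in aMy.
    have -> : (M a == M y) = false.
      by apply/eqP=> /(can_inj MK) Ma; rewrite Ma eqxx in ay.
    exact: MK.
  by rewrite -aMy (negPf ax) (negPf ay) eqxx.
have [->|ax] := eqVneq a x; first by [].
have [->|ay] := eqVneq a y; first by rewrite esym.
by have [->|aMy] := eqVneq a (M y); [rewrite eqxx | apply: Me].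
Qed.

Lemma card_missed_augment W M x y : x != y -> x \in W -> y \in W ->
  M x = x -> M y = y -> #|missed W (rematch M x y)| < #|missed W M|.
Proof.
move=> xy xW yW Mx My; apply/proper_card/properP; split.
  apply/subsetP=> a; rewrite !inE ffunE => /andP[-> /=].
  have [->|ax] := eqVneq a x; first by rewrite eq_sym (negPf xy).
  have [->|ay] := eqVneq a y; first by rewrite (negPf xy).
  by rewrite My (negPf ay).
exists x; first by rewrite inE xW Mx eqxx.
by rewrite inE xW ffunE eqxx eq_sym.
Qed.

Lemma card_missed_rotate W M x y : matching W M -> x != y -> x \in W -> y \in W ->
  M x = x -> M y != y -> #|missed W (rematch M x y)| = #|missed W M|.
Proof.
move=> mM xy xW yW Mx My; case/matchingP: (mM) => MK _.
have MyW : M y \in W by apply: matching_mem mM _.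
have Myx : M y != x by apply: contra_neq xy => Myx; rewrite -[y]MK Myx Mx.
have -> : missed W (rematch M x y) = M y |: (missed W M :\ x).
  apply/setP=> a; rewrite !inE ffunE.
  have [->|ax] := eqVneq a x.
    by rewrite [y == x]eq_sym (negPf xy) andbF [x == M y]eq_sym (negPf Myx).
  have [->|ay] := eqVneq a y.
    by rewrite (negPf xy) !(negPf My) [y == M y]eq_sym (negPf My) !andbF.
  by have [->|] := eqVneq a (M y); rewrite ?eqxx ?MyW.
rewrite cardsU1 !inE MyW Myx MK [y == _]eq_sym (negPf My) /=.
by rewrite [in RHS](cardsD1 x) inE xW Mx eqxx.
Qed.

(** Adjacent vertices satisfy this relation, and it composes through any vertex missed by some
    maximum matching, so it spreads along paths. *)
Definition not_jointly_missed W x y :=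
  forall M, maximum W M -> M x = x -> M y = y -> x = y.

Lemma not_jointly_missed_adj W x y :
  x \in W -> y \in W -> e x y -> not_jointly_missed W x y.
Proof.
move=> xW yW exy M [mM maxM] Mx My; apply/eqP; apply/contraT=> xy.
have := maxM _ (rematch_matching mM Mx xy xW yW exy).
by rewrite leqNgt card_missed_augment.
Qed.

(* The heart of Gallai's lemma. A maximum matching N missing t that agrees as
   much as possible with a maximum matching M missing x and y can be rotated
   along an edge of M so as to agree with M even more. *)
Lemma not_jointly_missed_trans W x t y : x \in W -> t \in W -> y \in W ->
  (exists2 N, maximum W N & N t = t) ->
  not_jointly_missed W x t -> not_jointly_missed W t y ->
  not_jointly_missed W x y.
Proof.
move=> xW tW yW [N0 maxN0 N0t] xt ty M maxM Mx My; apply/eqP/contraT=> xy.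
case: (maxM) => mM minM; case/matchingP: (mM) => MK Me.
have Mt : M t != t.
  apply: contra_neq xy => Mt; rewrite (xt M maxM Mx Mt).
  exact: ty M maxM Mt My.
have tx : t != x by apply: contraNneq Mt => ->; rewrite Mx.
have ty' : t != y by apply: contraNneq Mt => ->; rewrite My.
pose P N := [&& matching W N, #|missed W N| == #|missed W M| & N t == t].
have card_max N : maximum W N -> #|missed W N| = #|missed W M|.
  by case=> mN minN; apply/eqP; rewrite eqn_leq minM // minN.
have PN0 : P N0 by rewrite /P N0t card_max // !eqxx; case: maxN0 => ->.
pose agr N := #|[set a | N a == M a]|.
case: (@arg_maxnP _ N0 P agr PN0) => N /and3P[mN /eqP cN /eqP Nt] maxN.
have maximN : maximum W N by split=> // K mK; rewrite cN minM.
case/matchingP: (mN) => NK Ne.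
have Nx : N x != x by apply: contra_neq tx => Nx; rewrite (xt N maximN Nx Nt).
have Ny : N y != y by apply: contra_neq ty' => Ny; rewrite (ty N maximN Nt Ny).
(* [N] misses as many vertices as [M]; it covers [x] and [y], missed by [M], and misses [t], covered
   by [M]. Counting yields a second vertex like [t]. *)
have [a /and4P[aW Na Ma at_]] : exists a, [&& a \in W, N a == a, M a != a & a != t].
  apply/existsP; apply: contraT; rewrite negb_exists => /forallP none.
  have sub : missed W N \subset t |: (missed W M :\ x :\ y).
    apply/subsetP=> a; rewrite !inE => /andP[aW Na].
    have := none a; rewrite aW Na /= negb_and !negbK orbC => /orP[->//|->].
    have -> : a != y by apply: contraNneq Ny => <-.
    have -> : a != x by apply: contraNneq Nx => <-.
    by rewrite orbT.
  have := subset_leq_card sub; rewrite cardsU1 cN (cardsD1 x) (cardsD1 y (_ :\ x)).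
  by rewrite !inE xW yW Mx My !eqxx [y == x]eq_sym xy (negPf Mt) !andbF /= !add1n ltnn.
have [_ eab] := Me a Ma.
have Nb : N (M a) != M a.
  apply: contraNneq Ma => Nb; apply/eqP; symmetry.
  exact: (not_jointly_missed_adj aW (matching_mem mM aW) eab maximN (eqP Na) Nb).
set b := M a in Ma Nb eab.
have bW : b \in W by apply: matching_mem mM aW.
have ab : a != b by rewrite eq_sym.
have Mb : M b = a by rewrite MK.
have bt : b != t by apply: contraNneq Nb => ->; rewrite Nt.
have PN' : P (rematch N a b).
  rewrite /P rematch_matching ?card_missed_rotate ?(eqP Na) ?cN ?eqxx //=.
  rewrite ffunE ![t == _]eq_sym (negPf at_) (negPf bt).
  by case: (N b =P t) => [->|_]; rewrite ?Nt eqxx.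
(* Agreement is gained at [a] and never lost: agreement at [N b] would mean [M (N b) = b], hence
   [N b = a], which [N a = a] excludes. *)
have : agr (rematch N a b) <= agr N := maxN _ PN'; rewrite /agr leqNgt => /negP[]; apply/proper_card/properP; split.
  apply/subsetP=> c; rewrite !inE ffunE.
  have [->|ca] := eqVneq c a; first by rewrite eqxx.
  have [->|cb] := eqVneq c b; first by rewrite Mb eqxx.
  have [->|//] := eqVneq c (N b).
  rewrite NK => /eqP bE; case/eqP: ab.
  have : M (N b) = M a by rewrite -bE.
  by move/(can_inj MK) => E; rewrite -[RHS]NK E (eqP Na).
exists a; rewrite !inE ?ffunE ?eqxx //.
by rewrite (eqP Na).
Qed.

Lemma connect_not_jointly_missed W x y :
  (forall t, t \in W -> exists2 N, maximum W N & N t = t) ->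
  x \in W -> connect (induced e W) x y -> not_jointly_missed W x y.
Proof.
move=> allmiss xW /connectP[p pth ->] {y}.
elim: p x xW pth => [|t p IHp] x xW /=; first by move=> _ M.
case/andP=> /and3P[_ tW ext] pth.
have tl : last t p \in W.
  by apply: (connect_induced_mem (e := e) _ tW); apply/connectP; exists p.
apply: not_jointly_missed_trans (IHp t tW pth) => //; first exact: allmiss.
exact: not_jointly_missed_adj.
Qed.

(** By the previous lemma a component has at most one missed vertex, and a component containing one
    is odd since [M] pairs up the rest. *)
Lemma gallai W M : maximum W M ->
  (forall t, t \in W -> exists2 N, maximum W N & N t = t) ->
  #|missed W M| <= #|odd_components e W|.
Proof.
move=> maxM allmiss; case: (maxM) => mM _; case/matchingP: (mM) => MK Me.
have single x : x \in missed W M ->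
    [set y in class e W x | M y == y] = [set x].
  rewrite inE => /andP[xW /eqP Mx]; apply/setP=> y; rewrite !inE.
  apply/andP/eqP=> [[/andP[yW cxy] /eqP My]|->]; last by rewrite xW connect0 Mx.
  by symmetry; apply: (connect_not_jointly_missed allmiss xW cxy maxM).
have inj : {in missed W M &, injective (class e W)}.
  move=> x y xM yM E; have := single x xM; rewrite E (single y yM).
  by move/set1_inj.
rewrite -(card_in_imset inj); apply/subset_leq_card/subsetP=> _ /imsetP[x xM ->].
have xW : x \in W by move: xM; rewrite inE => /andP[].
rewrite inE; apply/andP; split; first exact: imset_f.
rewrite -(@odd_card_fixed _ M) ?single ?cards1 // => y; rewrite !inE.
case/andP=> yW cxy; rewrite (matching_mem mM yW) /=.
have [->//|My] := eqVneq (M y) y; have [_ eyMy] := Me y My.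
apply: connect_trans cxy (connect1 _).
by rewrite /induced yW (matching_mem mM yW).
Qed.

(** Induction on [#|W|]: if each vertex is missed by some maximum matching, Gallai's lemma applies
    with [X] empty; otherwise a vertex covered by all of them is deleted and put into [X]. *)
Lemma tutte_berge W : exists (X : {set V}) (M : {ffun V -> V}),
  [/\ X \subset W, matching W M &
      #|missed W M| + #|X| <= #|odd_components e (W :\: X)|].
Proof.
have [k le_k] := ubnP #|W|; elim: k W le_k => // k IHk W /ltnSE le_k.
have [M maxM] := maximum_exists W; case: (maxM) => mM minM.
have [allmiss|] := boolP [forall (t | t \in W),
    exists N : {ffun V -> V}, [&& matching W N, #|missed W N| == #|missed W M| & N t == t]].
  exists set0, M; rewrite sub0set cards0 addn0 setD0; split=> //.
  apply: gallai => // t tW; have /existsP[N] := forall_inP allmiss t tW.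
  case/and3P=> mN /eqP cN /eqP Nt; exists N => //; split=> // K mK.
  by rewrite cN minM.
rewrite negb_forall => /existsP[x]; rewrite negb_imply => /andP[xW].
rewrite negb_exists => /forallP nox.
have [|X [N [XW mN leN]]] := IHk (W :\ x).
  by move: le_k; rewrite (cardsD1 x) xW.
case/matchingP: (mN) => NK Ne.
have Nx : N x = x by apply/eqP/contraT => /Ne[]; rewrite !inE eqxx.
have mNW : matching W N.
  by apply/matchingP; split=> // a /Ne[]; rewrite inE => /andP[].
have missE : missed W N = x |: missed (W :\ x) N.
  apply/setP=> a; rewrite !inE; have [->|] //= := eqVneq a x.
  by rewrite xW Nx eqxx.
have cE : #|missed W N| = #|missed (W :\ x) N|.+1.
  by rewrite missE cardsU1 !inE eqxx.
have ltMN : #|missed W M| < #|missed W N|.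
  rewrite ltn_neqAle minM // andbT eq_sym; have := nox N.
  by rewrite mNW Nx eqxx andbT.
(* Equal parity turns the strict inequality into a gap of two: one for [x] being missed by [N], one
   for [x] joining [X]. *)
have par : odd #|missed W M| = odd #|missed W N|.
  case/matchingP: (mM) => MK _.
  by rewrite !odd_card_fixed // => a; apply: matching_mem.
have lt2 : #|missed W M| < #|missed (W :\ x) N|.
  by move: ltMN; rewrite cE ltnS leq_eqVlt => /orP[/eqP E|//]; move: par; rewrite cE E /=; case: odd.
exists (x |: X), M; split=> //.
  by rewrite subUset sub1set xW (subset_trans XW) // subsetDl.
have -> : W :\: (x |: X) = (W :\ x) :\: X by rewrite setDDl.
apply: leq_trans leN; rewrite cardsU1.
have -> : x \notin X by apply/negP=> /(subsetP XW); rewrite !inE eqxx.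
by rewrite /=; lia.
Qed.

End Matchings.

(** * Barriers of minimum cardinality *)

Section Barrier.

Variables (V : finType) (e : rel V).
Hypothesis esym : symmetric e.
Implicit Types (W X Y B : {set V}).

(* A barrier X of minimum cardinality has the last property: removing Y from X
   destroys at most the odd components adjacent to Y. *)
Lemma minimal_barrier W : ~~ odd #|W| ->
  (exists2 M, matching e W M & missed W M = set0) \/
  (exists X, [/\ X \subset W, #|X| + 2 <= #|odd_components e (W :\: X)| &
     forall Y, Y \subset X -> Y != set0 ->
       #|Y| + 2 <= #|adj_components e (W :\: X) Y|]).
Proof.
move=> evW; have [X0 [M [X0W mM leM]]] := tutte_berge esym W.
have [M0|M0] := eqVneq (missed W M) set0; first by left; exists M.
(* As [#|W|] is even, a set and its number of odd components have equal parity; every excess is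
   even, hence the constant 2. *)
have oddZ (Z : {set V}) : Z \subset W -> odd #|odd_components e (W :\: Z)| = odd #|Z|.
  move=> ZW; rewrite odd_card_odd_components // cardsDS // oddB ?subset_leq_card //.
  by rewrite (negPf evW).
pose P (X : {set V}) := (X \subset W) && (#|X| + 2 <= #|odd_components e (W :\: X)|).
have PX0 : P X0.
  rewrite /P X0W /=; have := oddZ X0 X0W; move: M0; rewrite -card_gt0.
  have : odd #|missed W M| = false.
    case/matchingP: (mM) => MK _; rewrite odd_card_fixed ?(negPf evW) //.
    by move=> a; apply: matching_mem mM.
  move: leM; move: #|missed W M| #|X0| #|odd_components _ _|; clear; lia.
case: (@arg_minnP _ X0 P (fun X => #|X|) PX0) => X /andP[XW leX] minX.
right; exists X; split=> // Y YX Yn0.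
have YW := subset_trans YX XW.
have XYW : X :\: Y \subset W by rewrite subDset subsetU // XW orbT.
have WE : W :\: (X :\: Y) = (W :\: X) :|: Y.
  by rewrite setDDr (setIidPr YW).
have cXY : #|X :\: Y| = #|X| - #|Y| by rewrite cardsDS.
have := subset_leq_card YX; have Y1 : 0 < #|Y| by rewrite card_gt0.
have nP : ~~ P (X :\: Y).
  apply/negP=> /minX /=; rewrite cXY; have := subset_leq_card YX.
  by move: Y1; move: #|X| #|Y|; clear; lia.
move: nP (oddZ _ XYW) (card_odd_components_setU esym (W :\: X) Y).
rewrite /P XYW WE cXY /=; move: leX Y1.
by move: #|X| #|Y| #|odd_components _ _| #|odd_components _ _| #|adj_components _ _ _|; clear; lia.
Qed.

(** Supplies upper bounds to confront with the lower bound [#|Y| + 2] of [minimal_barrier]. *)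
Lemma card_adj_components W Y B :
  (forall x y, x \in W -> y \in Y -> e x y ->
     exists2 b, b \in B & class e W x = class e W b) ->
  #|adj_components e W Y| <= #|B|.
Proof.
move=> repr; apply: leq_trans (leq_imset_card (class e W) B).
apply/subset_leq_card/subsetP=> C; rewrite !inE => /andP[/andP[Ccomp _]].
case/existsP=> x /andP[xC /existsP[y /andP[yY exy]]].
have xW : x \in W by case/imsetP: Ccomp xC => z _ ->; rewrite inE => /andP[].
have [b bB E] := repr x y xW yY exy.
by rewrite (component_class esym Ccomp xC) E imset_f.
Qed.

End Barrier.

(** * Tutte's gadget, turning f-factors into perfect matchings *)

Lemma card_set_sum (A B : finType) (a : pred A) (b : pred B) :
  #|[set p : A + B | match p with inl x => a x | inr y => b y end]|
  = #|[set x | a x]| + #|[set y | b y]|.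
Proof.
rewrite -!sum1_card big_sumType /=.
by congr (_ + _); apply: eq_bigl => x; rewrite !inE.
Qed.

Lemma card_set_tag (I : finType) (f : I -> nat) (A : {set I}) :
  #|[set p : {i : I & 'I_(f i)} | tag p \in A]| = \sum_(i in A) f i.
Proof.
rewrite -sum1_card (eq_bigl (fun p : {i : I & 'I_(f i)} => (tag p \in A) && true)).
  rewrite -(sig_big_dep _ (fun=> xpredT) (fun _ _ => 1)) /=.
  by apply: eq_bigr => i _; rewrite sum1_card card_ord.
by move=> p; rewrite inE andbT.
Qed.

Lemma card_set_pair (I J : finType) (A : {set I}) (r : I -> J -> bool) :
  #|[set d : I * J | (d.1 \in A) && r d.1 d.2]| = \sum_(i in A) #|[set j | r i j]|.
Proof.
rewrite -sum1_card (eq_bigl (fun d : I * J => (d.1 \in A) && r d.1 d.2)).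
  rewrite -(pair_big_dep (mem A) r (fun _ _ => 1)) /=.
  by apply: eq_bigr => i _; rewrite -sum1_card; apply: eq_bigl => j; rewrite inE.
by move=> p; rewrite inE.
Qed.

Section Factor.

Variables (V : finType) (e : rel V) (f : V -> nat).
Hypotheses (esym : symmetric e) (eirr : irreflexive e).
Hypothesis f_gt0 : forall x, 0 < f x.
Implicit Types (S T A R : {set V}) (x y : V).

(* Tutte's gadget: f x copies of each vertex x, and each edge xy replaced by the
   path x - (x,y) - (y,x) - y. The edge xy belongs to the factor when the two
   inner vertices of the path are not matched to each other. *)
Local Notation gvertex := ({x : V & 'I_(f x)} + V * V)%type.

Definition gadget : rel gvertex := fun p q =>
  match p, q with
  | inl a, inr d | inr d, inl a => tag a == d.1
  | inr d, inr d' => d' == (d.2, d.1)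
  | inl _, inl _ => false
  end.

Definition gadget_vertices : {set gvertex} :=
  [set p | match p with inl _ => true | inr d => e d.1 d.2 end].

Local Notation copy x i := (inl (@Tagged V x (fun z => 'I_(f z)) i) : gvertex).
Local Notation dart x y := (inr (x, y) : gvertex).
Local Notation W0 := gadget_vertices.

Lemma gadget_sym : symmetric gadget.
Proof.
move=> [a|[x y]] [b|[z t]] //=; apply/eqP/eqP=> -[-> ->] //.
Qed.

(** Reversal is an involution of the darts without fixed points, as there are no loops. *)
Lemma odd_card_gadget : odd #|W0| = odd (\sum_x f x).
Proof.
rewrite card_set_sum oddD; have -> : odd #|[set d : V * V | e d.1 d.2]| = false.
  rewrite -(@odd_card_fixed _ (fun d => (d.2, d.1))); last 2 first.
  - by case.
  - by move=> d; rewrite !inE esym.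
  rewrite (_ : [set _ in _ | _] = set0) ?cards0 //; apply/setP=> -[x y].
  by rewrite !inE /=; apply/negP=> /andP[exy /eqP[E _]]; rewrite E eirr in exy.
rewrite addbF; congr odd.
transitivity (\sum_(x in [set: V]) f x); last by apply: eq_bigl => x; rewrite inE.
by rewrite -card_set_tag; apply: eq_card => p; rewrite !inE.
Qed.

(** The [f x] copies of [x] are matched to distinct darts [(x, y)], and these [y] are exactly the
    neighbours of [x] in [F]. *)
Lemma gadget_factor M : matching gadget W0 M -> missed W0 M = set0 ->
  exists F : rel V, [/\ symmetric F, subrel F e & forall x, #|[set y | F x y]| = f x].
Proof.
move=> mM M0; case/matchingP: (mM) => MK Me.
have Mn p : p \in W0 -> M p != p /\ gadget p (M p).
  move=> pW; have Mp : M p != p.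
    by apply/negP=> Mp; have := in_set0 p; rewrite -M0 inE pW Mp.
  by split=> //; have [] := Me p Mp.
have Mcopy x i : exists2 y, M (copy x i) = dart x y & e x y.
  have cW : copy x i \in W0 by rewrite inE.
  have := matching_mem mM cW; have [_] := Mn _ cW.
  case: (M _) => // -[x' y] /= /eqP <-; rewrite inE /= => exy.
  by exists y.
have Mdart x y : e x y ->
    M (dart x y) = dart y x \/ exists i, M (dart x y) = copy x i.
  move=> exy; have dW : dart x y \in W0 by rewrite inE.
  have [_] := Mn _ dW; case: (M _) => [[x' i]|d] /= /eqP; last by move=> ->; left.
  by move=> E; move: i; rewrite E => i; right; exists i.
pose F x y := e x y && (M (dart x y) != dart y x).
exists F; split=> [x y|x y /andP[]//|x].
  rewrite /F esym; case: (e y x) => //=; congr negb; apply/eqP/eqP=> <-; exact: MK.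
have [g gE] : exists g, forall i, M (copy x i) = dart x (g i).
  exists (fun i => if M (copy x i) is inr d then d.2 else x) => i.
  by have [y -> _] := Mcopy x i.
have injg : injective g.
  move=> i j E; have := gE i; rewrite E -(gE j) => /(can_inj MK)/eqP.
  by rewrite (inj_eq inl_inj) => /eqP/eqP; rewrite eq_Tagged => /eqP.
rewrite -[RHS]card_ord -cardsT -(card_imset _ injg); apply: eq_card => y.
rewrite inE; apply/andP/imsetP=> [[exy]|[i _ ->]].
  have [->|[i E] _] := Mdart _ _ exy; first by rewrite eqxx.
  by exists i => //; have := gE i; rewrite -E MK => -[].
have [y' E exy'] := Mcopy x i; have := gE i; rewrite E => -[<-]; split=> //.
by rewrite -E MK.
Qed.


(** * Structure of a minimum barrier in the gadget *)

Section BarrierStructure.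

Variable X : {set gvertex}.
Hypothesis XW : X \subset W0.
Hypothesis Xodd : #|X| + 2 <= #|odd_components gadget (W0 :\: X)|.
Hypothesis Xadj : forall Y : {set gvertex}, Y \subset X -> Y != set0 ->
  #|Y| + 2 <= #|adj_components gadget (W0 :\: X) Y|.

Let O := W0 :\: X.
Let cls := class gadget O.

Lemma copyO x i : (copy x i \in O) = (copy x i \notin X).
Proof. by rewrite !inE andbT. Qed.

Lemma dartO x y : e x y -> (dart x y \in O) = (dart x y \notin X).
Proof. by move=> exy; rewrite !inE /= exy andbT. Qed.

Lemma dartO_edge x y : dart x y \in O -> e x y.
Proof. by rewrite !inE => /andP[]. Qed.

Lemma cls_adj p q : p \in O -> q \in O -> gadget p q -> cls p = cls q.
Proof. exact: (class_adj gadget_sym). Qed.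

(** Outside [X], the dart [(x, y)] is adjacent at most to [(y, x)] and to copies of [x], the latter
    all in the class of [(x, y')]: two classes against the three required. *)
Lemma barrier_dart x y y' :
  e x y -> e x y' -> dart x y \in X -> dart x y' \in X.
Proof.
move=> exy exy' dX; apply: contraT => d'X.
have : #|[set dart x y]| + 2 <= #|adj_components gadget O [set dart x y]|.
  by apply: Xadj; rewrite ?sub1set // -card_gt0 cards1.
suff : #|adj_components gadget O [set dart x y]| <= #|[set dart x y'; dart y x]|.
  by rewrite cards1 cards2 => h /leq_trans/(_ h); case: eqP.
apply: (card_adj_components gadget_sym) => p q pO /set1P->.
case: p pO => [[x' i]|[y1 x1]] pO /= /eqP.
  move=> E; move: i pO; rewrite E => i pO; exists (dart x y'); first by rewrite !inE eqxx.
  by apply: cls_adj; rewrite ?dartO //= eqxx.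
by case=> -> ->; exists (dart y1 x1); rewrite // !inE eqxx orbT.
Qed.

(** By [barrier_dart] all darts leaving [x] would lie in [X], so the copy would have no neighbour
    outside it. *)
Lemma barrier_copy_dart x i y : e x y -> copy x i \in X -> dart x y \notin X.
Proof.
move=> exy cX; apply/negP=> dX.
have : #|[set copy x i]| + 2 <= #|adj_components gadget O [set copy x i]|.
  by apply: Xadj; rewrite ?sub1set // -card_gt0 cards1.
suff : #|adj_components gadget O [set copy x i]| <= #|@set0 gvertex|.
  by rewrite cards1 cards0 => h /leq_trans/(_ h).
apply: (card_adj_components gadget_sym) => p q pO /set1P->.
case: p pO => [//|[x1 y1]] pO /= /eqP E; move: pO; rewrite -E => pO.
by have exy1 := dartO_edge pO; move: pO; rewrite dartO // (barrier_dart exy).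
Qed.

(** The neighbours of [copy x i] outside [X] are all adjacent to [copy x j], so they meet one class
    at most instead of three. *)
Lemma barrier_copy x i j : copy x i \in X -> copy x j \in X.
Proof.
move=> iX; apply: contraT => jX.
have : #|[set copy x i]| + 2 <= #|adj_components gadget O [set copy x i]|.
  by apply: Xadj; rewrite ?sub1set // -card_gt0 cards1.
suff : #|adj_components gadget O [set copy x i]| <= #|[set copy x j]|.
  by rewrite !cards1 => h /leq_trans/(_ h).
apply: (card_adj_components gadget_sym) => p q pO /set1P->.
case: p pO => [//|[x1 y1]] pO /= /eqP E; move: pO; rewrite -E => pO.
exists (copy x j); first by rewrite inE.
by apply: cls_adj; rewrite ?copyO //=.
Qed.

(** [X] is all or nothing on the copies of a vertex and on the darts leaving it, so two vertex sets
    encode it. *)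
Variables S T : {set V}.
Hypothesis copyX : forall x i, (copy x i \in X) = (x \in S).
Hypothesis dartX : forall x y, e x y -> (dart x y \in X) = (x \in T).
Hypothesis nbr : forall x, exists y, e x y.

Let c0 x := copy x (Ordinal (f_gt0 x)).

Lemma barrier_disjoint x : x \in T -> x \notin S.
Proof.
move=> xT; have [y exy] := nbr x; apply/negP=> xS.
have cX : c0 x \in X by rewrite copyX.
by have := barrier_copy_dart exy cX; rewrite dartX ?xT.
Qed.

Lemma card_barrier : #|X| = \sum_(x in S) f x + \sum_(x in T) #|[set y | e x y]|.
Proof.
rewrite -card_set_tag -card_set_pair.
rewrite -(card_set_sum (fun p => tag p \in S) (fun d => (d.1 \in T) && e d.1 d.2)).
apply: eq_card => -[[x i]|[x y]]; first by rewrite copyX inE.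
rewrite inE /=; have [exy|nexy] := boolP (e x y); first by rewrite dartX // andbT.
rewrite andbF; apply/negP=> /(subsetP XW); rewrite inE /=; exact/negP.
Qed.

Lemma cls_copy x i : x \notin S -> (exists2 y, e x y & x \notin T) ->
  cls (copy x i) = cls (c0 x).
Proof.
move=> xS [y exy xT]; have dO : dart x y \in O by rewrite dartO // dartX.
by rewrite -!(@cls_adj (dart x y)) ?copyO ?copyX //=.
Qed.

Lemma cls_dart x y : x \notin S -> x \notin T -> e x y -> cls (dart x y) = cls (c0 x).
Proof.
move=> xS xT exy; apply: cls_adj; last exact: eqxx; first by rewrite dartO ?dartX.
by rewrite copyO copyX.
Qed.

Lemma cls_reverse x y : x \notin T -> y \notin T -> e x y ->
  cls (dart x y) = cls (dart y x).
Proof.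
move=> xT yT exy; have eyx : e y x by rewrite esym.
by apply: cls_adj; rewrite ?dartO ?dartX //= eqxx.
Qed.

(** Each edge of the path lifts to its two darts, which avoid [X] because both ends avoid [T]. *)
Lemma cls_connect x y : x \in ~: (S :|: T) ->
  connect (induced e (~: (S :|: T))) x y -> cls (c0 x) = cls (c0 y).
Proof.
move=> xU /connectP[p pth ->] {y}.
elim: p x xU pth => //= y p IHp x xU /andP[/and3P[_ yU exy] pth].
rewrite -(IHp y yU pth); move: xU yU; rewrite !inE !negb_or.
move=> /andP[xS xT] /andP[yS yT].
by rewrite -(cls_dart xS xT exy) cls_reverse // cls_dart // esym.
Qed.

(** With the copies of both ends in [X], the two darts of the edge form a component of size two. *)
Lemma cls_pair x y : x \in S -> y \in S -> e x y -> dart x y \in O ->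
  ~~ odd #|cls (dart x y)|.
Proof.
move=> xS yS exy dO; have eyx : e y x by rewrite esym.
have xT : x \notin T by apply: contraL xS; apply: barrier_disjoint.
have yT : y \notin T by apply: contraL yS; apply: barrier_disjoint.
suff -> : cls (dart x y) = [set dart x y; dart y x].
  rewrite cards2 (_ : dart x y != dart y x) //.
  by apply: contraTneq exy => -[-> _]; rewrite eirr.
have cl : closed (induced gadget O) (mem [set dart x y; dart y x]).
  apply: intro_closed; first exact: (connect_induced_sym gadget_sym).
  move=> p q /and3P[_ qO gpq] /set2P[] E; move: gpq qO; rewrite {p}E.
    case: q => [[x' i]|[x' y']] /= /eqP.
      by move=> E; move: i; rewrite E => i; rewrite copyO copyX xS.
    by case=> -> -> _; rewrite !inE eqxx orbT.
  case: q => [[x' i]|[x' y']] /= /eqP.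
    by move=> E; move: i; rewrite E => i; rewrite copyO copyX yS.
  by case=> -> -> _; rewrite !inE eqxx.
apply/setP=> q; apply/idP/idP => [|/set2P[] ->].
- by rewrite inE => /andP[_ /(closed_connect cl) <-]; rewrite !inE eqxx.
- exact: class_refl.
rewrite cls_reverse //; apply: class_refl.
by rewrite dartO // dartX.
Qed.

(** Odd classes are represented by copies of vertices of [T] ([B1]), darts from [S] to [T] ([B2]) or
    one copy of each vertex of [R] ([B3]); darts between two vertices of [S] only form even
    classes. *)
Lemma card_odd_components_barrier R :
  (forall x, x \in ~: (S :|: T) ->
     exists2 y, y \in R & connect (induced e (~: (S :|: T))) x y) ->
  #|odd_components gadget O| <=
    \sum_(x in T) f x + \sum_(x in T) #|[set y in S | e x y]| + #|R|.
Proof.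
move=> hitR.
pose B1 : {set gvertex} := inl @: [set q : {x : V & 'I_(f x)} | tag q \in T].
pose B2 : {set gvertex} := (fun d => dart d.2 d.1) @:
  [set d : V * V | (d.1 \in T) && ((d.2 \in S) && e d.1 d.2)].
pose B3 : {set gvertex} := c0 @: R.
have sub : odd_components gadget O \subset cls @: (B1 :|: B2 :|: B3).
  apply/subsetP=> C; rewrite inE => /andP[Ccomp oddC].
  have [p pC] : exists p, p \in C.
    by apply/set0Pn; apply: contraTneq oddC => ->; rewrite cards0.
  have pO : p \in O by case/imsetP: Ccomp pC => z _ ->; rewrite inE => /andP[].
  rewrite (component_class gadget_sym Ccomp pC) in oddC *.
  have inU x : x \notin S -> x \notin T -> cls p = cls (c0 x) ->
      cls p \in cls @: (B1 :|: B2 :|: B3).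
    move=> xS xT ->; have xU : x \in ~: (S :|: T) by rewrite !inE negb_or xS.
    have [y yR cxy] := hitR x xU; rewrite (cls_connect xU cxy).
    by apply/imset_f/setUP; right; apply: imset_f.
  case: p pC pO oddC inU => [[x i]|[x y]] pC pO oddC inU.
    have xS : x \notin S by rewrite -(copyX i) -copyO.
    have [xT|xT] := boolP (x \in T).
      apply/imset_f/setUP; left; apply/setUP; left; apply: imset_f.
      by rewrite inE.
    apply: (inU x) => //; apply: cls_copy => //.
    by have [y exy] := nbr x; exists y.
  have exy := dartO_edge pO; have eyx : e y x by rewrite esym.
  have xT : x \notin T by rewrite -(dartX exy) -dartO.
  have [xS|xS] := boolP (x \in S); last by apply: (inU x) => //; apply: cls_dart.
  have [yT|yT] := boolP (y \in T).
    apply/imset_f/setUP; left; apply/setUP; right.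
    by apply/imsetP; exists (y, x) => //; rewrite inE /= yT xS.
  have [yS|yS] := boolP (y \in S); first by rewrite (negPf (cls_pair xS yS exy pO)) in oddC.
  by apply: (inU y) => //; rewrite cls_reverse // cls_dart.
apply: leq_trans (subset_leq_card sub) _; apply: leq_trans (leq_imset_card _ _) _.
apply: leq_trans (leq_card_setU _ _) _; apply: leq_add; last exact: leq_imset_card.
apply: leq_trans (leq_card_setU _ _) _; apply: leq_add.
  by rewrite -card_set_tag leq_imset_card.
apply: leq_trans (leq_imset_card _ _) _.
rewrite (card_set_pair T (fun x y => (y \in S) && e x y)).
by apply: eq_leq; apply: eq_bigr => x _; apply: eq_card => y; rewrite !inE.
Qed.

(** For the set of all darts leaving [x], minimality compares their number with their possible
    neighbours outside [X]: the [f x] copies of [x] and the reversed darts from vertices outside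
    [T]. *)
Lemma barrier_degree x : x \in T -> #|[set y in T | e x y]| + 2 <= f x.
Proof.
move=> xT; pose Y : {set gvertex} := inr @: ((fun y => (x, y)) @: [set y | e x y]).
have cY : #|Y| = #|[set y | e x y]|.
  rewrite card_imset; last exact: inr_inj.
  by rewrite card_imset // => y y' [].
pose B : {set gvertex} := (fun i => copy x i) @: [set: 'I_(f x)] :|:
   (fun y => dart y x) @: [set y in ~: T | e x y].
have cB : #|B| <= f x + #|[set y in ~: T | e x y]|.
  apply: leq_trans (leq_card_setU _ _) _; apply: leq_add; last exact: leq_imset_card.
  by apply: leq_trans (leq_imset_card _ _) _; rewrite cardsT card_ord.
have YX : Y \subset X.
  apply/subsetP=> _ /imsetP[_ /imsetP[y exy ->] ->]; rewrite inE in exy.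
  by rewrite dartX.
have Yn0 : Y != set0.
  have [y exy] := nbr x; apply/set0Pn; exists (dart x y).
  by do 2!apply: imset_f; rewrite inE.
have := Xadj YX Yn0.
have : #|adj_components gadget O Y| <= #|B|.
  apply: (card_adj_components gadget_sym) => p _ pO /imsetP[_ /imsetP[y exy ->] ->].
  rewrite inE in exy; move=> gp; exists p => //; move: pO gp.
  case: p => [[x' i]|[y' x']] pO /= /eqP E.
    by move: i pO; rewrite E => i _; apply/setUP; left; apply: imset_f.
  case: E pO => <- <- pO; apply/setUP; right; apply: imset_f.
  by rewrite !inE exy andbT -(dartX (dartO_edge pO)) -dartO // dartO_edge.
have cS : #|[set y | e x y]| = #|[set y in T | e x y]| + #|[set y in ~: T | e x y]|.
  rewrite -(cardsID T [set y | e x y]); congr (_ + _); apply: eq_card => y;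
    by rewrite !inE // andbC.
rewrite cY cS; move: cB; move: #|_| #|_| #|_| #|_| => a b c d; lia.
Qed.

End BarrierStructure.

(* A weak form of Tutte's f-factor theorem, where R stands for a set meeting every
   component of the graph without S and T. *)
Lemma factor_obstruction : ~~ odd (\sum_x f x) -> (forall x, exists y, e x y) ->
  (exists F : rel V, [/\ symmetric F, subrel F e & forall x, #|[set y | F x y]| = f x]) \/
  (exists S T, [/\ [disjoint S & T],
     forall x, x \in T -> #|[set y in T | e x y]| + 2 <= f x &
     forall R, (forall x, x \in ~: (S :|: T) ->
         exists2 y, y \in R & connect (induced e (~: (S :|: T))) x y) ->
       \sum_(x in S) f x + \sum_(x in T) #|[set y in ~: S | e x y]| + 2
       <= \sum_(x in T) f x + #|R|]).
Proof.
move=> evf nbr; rewrite -odd_card_gadget in evf.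
case: (minimal_barrier gadget_sym evf) => [[M mM M0]|[X [XW Xodd Xadj]]].
  by left; apply: gadget_factor M0.
pose S := [set x | [exists i : 'I_(f x), copy x i \in X]].
pose T := [set x | [exists y, e x y && (dart x y \in X)]].
have copyX x i : (copy x i \in X) = (x \in S).
  by rewrite inE; apply/idP/existsP => [|[j]]; [exists i | apply: barrier_copy].
have dartX x y : e x y -> (dart x y \in X) = (x \in T).
  move=> exy; rewrite inE; apply/idP/existsP => [dX|[y' /andP[exy' dX]]].
    by exists y; rewrite exy.
  exact: (barrier_dart Xadj exy').
clearbody S T; right; exists S, T; split.
- rewrite disjoint_sym disjoints_subset; apply/subsetP=> x xT; rewrite inE.
  exact: (barrier_disjoint Xadj copyX dartX nbr).
- exact: (barrier_degree XW Xodd Xadj dartX nbr).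
move=> R hitR; have := card_odd_components_barrier Xadj copyX dartX nbr hitR.
move: Xodd; rewrite (card_barrier XW copyX dartX).
(* Edges between [T] and [S] occur both in the size of [X] and in the bound on odd components, and
   cancel. *)
have -> : \sum_(x in T) #|[set y | e x y]| =
   \sum_(x in T) #|[set y in S | e x y]| + \sum_(x in T) #|[set y in ~: S | e x y]|.
  rewrite -big_split /=; apply: eq_bigr => x _.
  rewrite -(cardsID S [set y | e x y]); congr (_ + _); apply: eq_card => y;
    by rewrite !inE // andbC.
by move: (\sum_(x in S) _) (\sum_(x in T) _) (\sum_(x in T) _) (\sum_(x in T) _) #|_| #|R|; lia.
Qed.

End Factor.

(** * The cone and near r-factors *)

Lemma sum_option (V : finType) (A : {set option V}) (F : option V -> nat) :
  \sum_(a in A) F a =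
  (None \in A) * F None + \sum_(x in [set x | Some x \in A]) F (Some x).
Proof.
rewrite big_mkcond (bigD1 None) //=; congr (_ + _); first by case: ifP => _; lia.
rewrite -big_mkcondr (reindex_omap Some id) /=; last by case.
by apply: eq_bigl => x; rewrite !inE eqxx andbT.
Qed.

Lemma card_option_set (V : finType) (A : {set option V}) :
  #|A| = (None \in A) + #|[set x | Some x \in A]|.
Proof. by rewrite -!sum1_card sum_option muln1. Qed.

Section Cone.

Variables (V : finType) (m : V -> V -> nat) (r : nat).
Hypothesis hG : multigraph m.
Hypothesis no_isolated : forall x, exists y, 0 < m x y.
Hypothesis V_gt0 : 0 < #|V|.

Local Notation adj := (fun x y => (0 < m x y)).

(* A factor of the cone with degree r + 1 at the vertices of the graph and with
   an apex of degree #|V| or #|V| - 1 is a near r-factor together with the edges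
   from the apex to the vertices of degree r. *)
Definition cone : rel (option V) := fun a b =>
  match a, b with
  | Some x, Some y => 0 < m x y
  | None, None => false
  | _, _ => true
  end.

(** The apex loses one when [r * #|V|] is odd, which makes the degree sum even. *)
Definition cone_degree (a : option V) : nat :=
  if a is Some _ then r.+1 else #|V| - odd (r * #|V|).

Lemma cone_sym : symmetric cone.
Proof. by case: hG => msym _ [x|] [y|] //=; rewrite msym. Qed.

Lemma cone_irr : irreflexive cone.
Proof. by case: hG => _ mirr [x|] //=; rewrite mirr. Qed.

Lemma cone_neighbor a : exists b, cone a b.
Proof.
case: a => [x|]; first by exists None.
by case/card_gt0P: V_gt0 => x _; exists (Some x).
Qed.

Lemma cone_degree_gt0 a : 0 < cone_degree a.
Proof.
case: a => //=; suff : 1 < #|V| by move: #|V| => k; case: odd => /=; lia.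
case: hG => _ mirr; case/card_gt0P: V_gt0 => x _; have [y xy] := no_isolated x.
have xny : x != y by apply: contraTneq xy => ->; rewrite mirr.
by have := max_card (mem [set x; y]); rewrite cards2 xny.
Qed.

Lemma cone_degree_even : ~~ odd (\sum_a cone_degree a).
Proof.
have -> : \sum_a cone_degree a = \sum_(a in [set: option V]) cone_degree a.
  by apply: eq_bigl => a; rewrite inE.
rewrite sum_option inE mul1n /= sum_nat_const.
have -> : #|[set x : V | Some x \in [set: option V]]| = #|V|.
  by rewrite -cardsT; apply: eq_card => x; rewrite !inE.
by rewrite oddD oddB ?oddM /=; case: (odd r); case Ho: (odd #|V|) => //=; lia.
Qed.

Lemma near_factor_of_cone (F : rel (option V)) :
  symmetric F -> subrel F cone -> (forall a, #|[set b | F a b]| = cone_degree a) ->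
  has_near_factor m r.
Proof.
move=> Fsym Fsub Fdeg; case: (hG) => msym mirr.
pose F0 x y : nat := F (Some x) (Some y).
have degF x : deg F0 x + F (Some x) None = r.+1.
  have := Fdeg (Some x); rewrite /= => <-; rewrite card_option_set inE addnC.
  congr (_ + _); rewrite /deg -sum1_card [RHS]big_mkcond /=.
  by apply: eq_bigr => y _; rewrite !inE /F0; case: (F _ _).
exists F0; split; first split; first split.
- by move=> x y; rewrite /F0 Fsym.
- by move=> x; apply/eqP; rewrite eqb0; apply/negP=> /Fsub /=; rewrite mirr.
- by move=> x y; rewrite /F0; case Fxy: (F _ _) => //; apply: (Fsub _ _ Fxy).
split=> [x|x y dx dy].
  by have := degF x; case: (F _ _); lia.
(* Two vertices of degree [r.+1] would both be non-neighbours of the apex, whose degree is at least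
   [#|V| - 1]. *)
apply/eqP/contraT=> xny.
have nF z : deg F0 z = r.+1 -> z \notin [set z | Some z \in [set b | F None b]].
  by have := degF z; rewrite !inE Fsym; case: (F _ _) => //; lia.
have := Fdeg None; rewrite card_option_set inE /=.
have -> : F None None = false by apply/negP=> /Fsub.
have sub : [set z | Some z \in [set b | F None b]] \subset ~: [set x; y].
  apply/subsetP=> z zF; rewrite in_setC; apply/negP=> /set2P[] E; move: zF;
    rewrite E; exact/negP/nF.
have := subset_leq_card sub; have := cardsC [set x; y]; rewrite cards2 xny.
rewrite /= add0n => h1 h2 h3; rewrite h3 in h2; move: h1 h2.
by case: odd; move: #|~: _| #|V| => a b; lia.
Qed.

End Cone.

(** * Degree deficits and isolated vertices *)

Local Open Scope ring_scope.

(* Greedy choice: take a vertex of maximum weight and discard its neighbours. *)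
Lemma greedy_independent (R : realDomainType) (V : finType) (e : rel V)
    (w : V -> R) (k : nat) (B : {set V}) :
  symmetric e -> irreflexive e ->
  (forall x, x \in B -> (#|[set y in B | e x y]| < k)%N) ->
  exists I : {set V}, [/\ I \subset B, {in I &, forall x y, ~~ e x y} &
    \sum_(x in B) w x <= k%:R * \sum_(x in I) w x].
Proof.
move=> esym eirr; have [n le_n] := ubnP #|B|; elim: n B le_n => // n IHn B le_n degB.
have [B0|[x0 x0B]] := set_0Vmem B.
  exists set0; split; rewrite ?sub0set //; first by move=> x y; rewrite inE.
  by rewrite B0 !big_set0 mulr0.
case: (@Order.TotalTheory.arg_maxP _ _ _ x0 (mem B) w x0B) => x xB maxx.
have {}xB : x \in B := xB.
(* The empty set settles a nonpositive maximum; below, bounding at most [k] terms by [k] times [w x]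
   needs [w x] nonnegative. *)
have [wx|wx] := lerP (w x) 0.
  exists set0; split; rewrite ?sub0set //; first by move=> y z; rewrite inE.
  rewrite big_set0 mulr0; apply: sumr_le0 => y yB.
  by apply: le_trans wx; apply: maxx.
pose N := x |: [set y in B | e x y].
have [||I [IB indI leI]] := IHn (B :\: N).
- rewrite -ltnS; apply: leq_trans _ le_n; rewrite ltnS; apply: proper_card.
  apply/properP; split; first exact: subsetDl.
  by exists x; rewrite // !inE eqxx.
- move=> y; rewrite inE => /andP[_ yB]; apply: leq_ltn_trans (degB y yB).
  apply/subset_leq_card/subsetP=> z; rewrite !inE => /andP[/andP[_ ->]].
  by move=> ->.
have IN y : y \in I -> [/\ y \in B, y != x & ~~ e x y].
  move=> /(subsetP IB); rewrite !inE negb_or => /andP[/andP[yx]].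
  by move=> h yB; rewrite yB in h *.
exists (x |: I); split.
- by rewrite subUset sub1set xB (subset_trans IB) // subsetDl.
- move=> y z /setU1P[->|yI] /setU1P[->|zI]; first by rewrite eirr.
  + by have [] := IN z zI.
  + by rewrite esym; have [] := IN y yI.
  exact: indI.
have xI : x \notin I by apply/negP=> /IN[]; rewrite eqxx.
rewrite big_setU1 //= mulrDr (big_setID N) /= lerD //.
apply: le_trans (_ : \sum_(y in B :&: N) w x <= _).
  by apply: ler_sum => y; rewrite inE => /andP[yB _]; apply: maxx.
rewrite sumr_const -[leLHS]mulr_natl ler_wpM2r ?(ltW wx) // ler_nat.
apply: leq_trans (subset_leq_card (subsetIr _ _)) _.
apply: leq_trans (degB x xB).
by rewrite cardsU1 !inE eirr andbF.
Qed.

Section Isolated.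

Variables (R : realFieldType) (V : finType) (m : V -> V -> nat) (c : R) (r : nat).
Hypothesis hG : multigraph m.
Hypothesis c_ge0 : 0 <= c.
Hypothesis r_gt0 : (0 < r)%N.
Hypothesis hiso : forall S : {set V}, (iso m S)%:R <= #|S|%:R / (r%:R + c).

Local Notation adj := (fun x y => (0 < m x y)%N).

(** Deleting [S] and the neighbours of [I] isolates [I], and the degree sum bounds the number of
    those neighbours outside [S]. *)
Lemma independent_iso (S I : {set V}) :
  [disjoint I & S] -> {in I &, forall x y, ~~ adj x y} ->
  #|I|%:R * (r%:R + c) <= (#|S| + \sum_(x in I) #|[set y in ~: S | adj x y]|)%:R.
Proof.
case: hG => msym _ disI indI.
have d_gt0 : 0 < r%:R + c by rewrite ltr_wpDr // ltr0n.
pose nb := \bigcup_(x in I) [set y in ~: S | adj x y].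
have le_nb : (#|nb| <= \sum_(x in I) #|[set y in ~: S | adj x y]|)%N.
  rewrite /nb; elim/big_rec2: _ => [|x k A _ le_k]; first by rewrite cards0.
  by apply: leq_trans (leq_card_setU _ _) _; rewrite leq_add2l.
have le_I : (#|I| <= iso m (S :|: nb))%N.
  apply/subset_leq_card/subsetP=> x xI; rewrite !inE negb_or.
  rewrite (disjointFr disI xI) /=; apply/andP; split.
    apply/bigcupP=> -[y yI]; rewrite !inE => /andP[_].
    by apply/negP/indI.
  apply/forall_inP=> y; rewrite !inE negb_or => /andP[yS ynb].
  rewrite -leqn0 leqNgt; apply: contra ynb => xy.
  by apply/bigcupP; exists x; rewrite // !inE yS.
rewrite -ler_pdivlMr //; apply: le_trans (_ : (iso m (S :|: nb))%:R <= _).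
  by rewrite ler_nat.
apply: le_trans (hiso _) _; rewrite ler_pM2r ?invr_gt0 // ler_nat.
by apply: leq_trans (leq_card_setU _ _) _; rewrite leq_add2l.
Qed.

(** The greedy choice is applied to the weight [w], and [independent_iso] bounds the weight of [I]
    by [#|S|]. *)
Lemma degree_deficit_bound (S B : {set V}) (k : nat) :
  [disjoint S & B] ->
  (forall x, x \in B -> (#|[set y in B | adj x y]| < k)%N) ->
  (r%:R + c) * #|B|%:R <=
    k%:R * #|S|%:R + (\sum_(x in B) #|[set y in ~: S | adj x y]|)%:R.
Proof.
case: (hG) => msym mirr disB degB.
pose w x : R := r%:R + c - #|[set y in ~: S | adj x y]|%:R.
have [x y|x|I [IB indI]] := greedy_independent w _ _ degB; first by rewrite msym.
  by rewrite mirr.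
have sumw (A : {set V}) : \sum_(x in A) w x =
    (r%:R + c) * #|A|%:R - (\sum_(x in A) #|[set y in ~: S | adj x y]|)%:R.
  by rewrite sumrB sumr_const mulr_natr natr_sum.
have disI : [disjoint I & S] by rewrite disjoint_sym (disjointWr IB).
have := independent_iso disI indI; rewrite natrD !sumw mulrC -lerBlDr => leI.
rewrite lerBlDr => /le_trans; apply; rewrite lerD2r.
by rewrite ler_wpM2l.
Qed.

End Isolated.

(** * Existence of the near r-factor, by the position of the apex *)

Lemma near_factor_exists (R : realFieldType) (V : finType) (m : V -> V -> nat)
  (r : nat) (n : R) :
  multigraph m -> (0 < r)%N -> 1 <= n ->
  (forall S : {set V}, (iso m S)%:R <= #|S|%:R / (r%:R + n^-1) :> R) ->
  (forall S : {set V}, (omega m S)%:R < #|S|%:R / n + 2 :> R) ->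
  has_near_factor m r.
Proof.
move=> hG r_gt0 n_ge1 hiso homega; case: (hG) => msym mirr.
have n_gt0 : 0 < n by apply: lt_le_trans n_ge1.
have c_ge0 : 0 <= n^-1 by rewrite invr_ge0 ltW.
have c_le1 : n^-1 <= 1 by rewrite invf_le1.
have [V0|V_gt0] := posnP #|V|.
  exists m; split; first by split.
  by split=> [x|x y]; have := card0_eq V0 x; rewrite !inE.
have nbr x : exists y, (0 < m x y)%N.
  have := hiso set0; rewrite cards0 mul0r lern0 cards_eq0 => /eqP/setP/(_ x).
  rewrite !inE /= => /negbT/forall_inPn[y _ xy]; exists y; by rewrite lt0n.
case: (factor_obstruction (cone_sym hG) (cone_irr hG)
  (cone_degree_gt0 r hG nbr V_gt0) (cone_degree_even r V_gt0) (cone_neighbor m V_gt0))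
  => [[F [Fsym Fsub Fdeg]]|[S [T [disST degT obs]]]].
  exact: near_factor_of_cone Fsym Fsub Fdeg.
exfalso.
pose S0 := [set x | Some x \in S]; pose T0 := [set x | Some x \in T].
have disST0 : [disjoint S0 & T0].
  rewrite disjoints_subset; apply/subsetP=> x; rewrite !inE => xS.
  by rewrite (disjointFr disST xS).
have degT0 x : x \in T0 ->
    ((None \in T) + #|[set y in T0 | (0 < m x y)%N]| + 2 <= r.+1)%N.
  rewrite inE => xT; apply: leq_trans _ (degT _ xT).
  rewrite card_option_set !inE andbT; apply: eq_leq; congr (_ + _ + _)%N.
  by apply: eq_card => y; rewrite !inE.
pose d := (\sum_(x in T0) #|[set y in ~: S0 | (0 < m x y)%N]|)%N.
have obsN (Q : {set option V}) : (forall x, x \in ~: (S :|: T) ->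
      exists2 y, y \in Q & connect (induced (cone m) (~: (S :|: T))) x y) ->
    ((None \in S) * (#|V| - odd (r * #|V|)) + r.+1 * #|S0| +
     ((None \in T) * #|~: S0| + (None \notin S) * #|T0| + d) + 2 <=
     (None \in T) * (#|V| - odd (r * #|V|)) + r.+1 * #|T0| + #|Q|)%N.
  move=> /obs; rewrite !sum_option /= !sum_nat_const -/S0 -/T0 ![(_ * r.+1)%N]mulnC.
  rewrite (_ : #|[set y in ~: S | cone m None y]| = #|~: S0|); last first.
    rewrite card_option_set !inE andbF; apply: eq_card => y.
    by rewrite !inE andbT.
  rewrite (_ : \sum_(x in T0) _ = (None \notin S) * #|T0| + d)%N ?addnA //.
  rewrite mulnC -sum_nat_const -big_split; apply: eq_bigr => x _.
  rewrite card_option_set !inE andbT; congr (_ + _)%N.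
  by apply: eq_card => y; rewrite !inE.
have dbound k := @degree_deficit_bound R V m n^-1 r hG c_ge0 r_gt0 hiso S0 T0 k disST0.
rewrite -/d in dbound; clearbody d.
have nT_pos : 0 <= n^-1 * #|T0|%:R by rewrite mulr_ge0.
have dbound_r : (r * #|T0| <= r * #|S0| + d)%N.
  rewrite -(ler_nat R) natrD !natrM; apply: le_trans _ (dbound r _).
    by rewrite mulrDl lerDl.
  by move=> x /degT0; move: #|_|; clear; lia.
have cV := cardsC S0.
(* Apex in [S]: every remaining vertex may represent itself, since the apex degree pays for all of
   [V] up to one vertex. *)
have [NS|NS] := boolP (None \in S).
  have NT : None \notin T by rewrite (disjointFr disST NS).
  have /obsN : forall x, x \in ~: (S :|: T) -> exists2 y, y \in ~: (S :|: T) &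
      connect (induced (cone m) (~: (S :|: T))) x y.
    by move=> x xU; exists x; rewrite ?connect0.
  rewrite NS (negPf NT) card_option_set !inE NS /=.
  have : (#|S0| + #|T0| + #|[set x | Some x \in ~: (S :|: T)]| = #|V|)%N.
    rewrite -(cardsC (S0 :|: T0)) cardsU (_ : S0 :&: T0 = set0) ?cards0 ?subn0.
      by congr (_ + _)%N; apply: eq_card => x; rewrite !inE.
    by apply/eqP; rewrite setI_eq0.
  move: dbound_r; rewrite !mulSn !mul0n !addn0 !add0n.
  move: (r * #|S0|)%N (r * #|T0|)%N #|S0| #|T0| #|[set x | _]| #|V|; clear; lia.
(* Apex in neither set: it is adjacent to everything left, so it is the only representative
   needed. *)
have [NT|NT] := boolP (None \in T); last first.
  have /obsN : forall x, x \in ~: (S :|: T) -> exists2 y, y \in [set None] &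
      connect (induced (cone m) (~: (S :|: T))) x y.
    move=> x xU; exists None; rewrite ?inE //; case: x xU => [x|] xU //.
    by apply: connect1; rewrite /induced xU !inE negb_or NS NT.
  rewrite (negPf NS) (negPf NT) cards1.
  move: dbound_r; rewrite !mulSn !mul0n ?addn0 ?add0n.
  by move: (r * #|S0|)%N (r * #|T0|)%N #|S0| #|T0|; clear; lia.
(* Apex in [T]: the component roots of the graph without [S1] are the representatives, which brings
   in [omega]. *)
pose S1 := S0 :|: T0.
pose reps := [set Some x | x in [set fingraph.root (adjD m S1) x | x in ~: S1]].
have /obsN : forall x, x \in ~: (S :|: T) -> exists2 y, y \in reps &
      connect (induced (cone m) (~: (S :|: T))) x y.
  case=> [x|]; last by rewrite !inE NT orbT.
  move=> xU; have xS1 : x \in ~: S1 by move: xU; rewrite !inE.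
  exists (Some (fingraph.root (adjD m S1) x)); first by do 2!apply: imset_f.
  case/connectP: (connect_root (adjD m S1) x) => p pth ->.
  apply/connectP; exists (map Some p); last by rewrite last_map.
  apply: homo_path pth => y z /and3P[yS zS yz]; rewrite /induced /= yz andbT.
  by move: yS zS; rewrite !inE => -> ->.
rewrite NT (negPf NS) card_imset; last by move=> x y [].
rewrite -/(omega m S1) => le1.
have le2 : (r * #|S0| + d + 2 <= r * #|T0| + omega m S1)%N.
  move: le1 cV; rewrite !mulSn !mul0n ?addn0 ?add0n.
  by move: (r * #|S0|)%N (r * #|T0|)%N #|S0| #|T0| #|~: S0| #|V| (omega _ _); clear; lia.
have cS1 : (#|S1| <= #|S0| + #|T0|)%N by apply: leq_card_setU.
have := homega S1.
have : #|S1|%:R / n <= (#|S0|%:R + #|T0|%:R) / n :> R.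
  by rewrite ler_pM2r ?invr_gt0 // -natrD ler_nat.
(* The apex counts as a neighbour inside [T], which improves the degree bound in [T0] from [r] to
   [r.-1]. *)
have /dbound : forall x, x \in T0 -> (#|[set y in T0 | (0 < m x y)%N]| < r.-1)%N.
  by move=> x /degT0; rewrite NT; move: #|_| r_gt0; clear; lia.
move: le2; rewrite -(ler_nat R) !natrD !natrM.
have -> : r.-1%:R = r%:R - 1 :> R by rewrite -subn1 natrB.
(* The inequalities combine to [#|S0| < #|S0| / n], impossible as [n] is at least 1. *)
have : n^-1 * #|S0|%:R <= #|S0|%:R by rewrite ler_piMl.
rewrite !mulrDl ![_ / n]mulrC.
lra.
Qed.

Theorem mainTheorem8 (R : realFieldType) (T : finType) (m : T -> T -> nat)
  (hG : multigraph m) (r : nat) (hr : (0 < r)%N) :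
  (forall n : R, (1 <= n)%R ->
     (forall S : {set T}, ((iso m S)%:R <= (#|S|)%:R / (r%:R + n^-1) :> R)%R) ->
     (forall S : {set T}, ((omega m S)%:R < (#|S|)%:R / n + 2 :> R)%R) ->
     has_near_factor m r) /\
  (tough m (1 : R) ->
     (forall S : {set T}, ((iso m S)%:R <= (#|S|)%:R / (r%:R + 1) :> R)%R) ->
     has_near_factor m r).
Proof.
split=> [n n1 hiso homega|htough hiso]; first exact: near_factor_exists n1 hiso homega.
(* With [n = 1], toughness bounds [omega] by the maximum of 1 and [#|S|], which is below
   [#|S| + 2]. *)
apply: (@near_factor_exists R _ _ _ 1) => // S; first by rewrite invr1.
apply: le_lt_trans (htough S) _; rewrite divr1 gt_max.
by have : 0 <= #|S|%:R :> R by []; lra.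
Qed.
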